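(* Let $S$ be a $\mathrm{Cu}$-semigroup. Let $x,y\in\mathrm{Full}(S)$ with $x\leq y$, and let $\mathcal{F}_y(S)\neq\emptyset$. Then: (1) $\frac{1}{\rho(x,y)}\cdot\mathrm{rc}(S,y)\leq\mathrm{rc}(S,x)$. (2) If further $\rho(y,x)<\infty$, then $$\frac{1}{\rho(x,y)}\cdot\mathrm{rc}(S,y)\leq\mathrm{rc}(S,x)\leq\rho(y,x)\cdot\mathrm{rc}(S,y).$$
   Context: For elements $x,y$ of a partially ordered set $P$, $x\ll y$ means: for every increasing sequence $(y_n)$ in $P$ with supremum $y$ there is $n_0$ with $x\leq y_{n_0}$. A $\mathrm{Cu}$-semigroup is a positively ordered abelian monoid $S$ (so $0\leq x$ for all $x$ and the order is compatible with addition) such that: (O1) every increasing sequence in $S$ has a supremum; (O2) every $x\in S$ is the supremum of a sequence $x_0\ll x_1\ll x_2\ll\cdots$; (O3) if $x'\ll x$ and $y'\ll y$ then $x'+y'\ll x+y$; (O4) $\sup_n(x_n+y_n)=\sup_n x_n+\sup_n y_n$ for all increasing sequences $(x_n),(y_n)$. For $x\in S$, $\infty\cdot x=\sup_n n\cdot x$. An element $x$ is full if $\infty\cdot x$ is the largest element of $S$; $\mathrm{Full}(S)$ is the set of full elements. A functional on $S$ is a map $\lambda\colon S\to[0,\infty]$ that is additive, order preserving, satisfies $\lambda(0)=0$, and preserves suprema of increasing sequences. $\mathcal{F}(S)$ is the set of functionals on $S$, and $\mathcal{F}_z(S)=\{\lambda\in\mathcal{F}(S):\lambda(z)=1\}$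 for $z\in S$. The rank of $x$ is $\widehat{x}\colon\mathcal{F}(S)\to[0,\infty]$, $\widehat{x}(\lambda)=\lambda(x)$; inequalities between ranks are pointwise on $\mathcal{F}(S)$. Rank ratio: $\rho(x,y)=\inf\{r\in(0,\infty):\widehat{x}\leq r\cdot\widehat{y}\}$, with $\rho(x,y)=\infty$ if there is no such $r$. Radius of comparison: for $w\in\mathrm{Full}(S)$ and $r\in(0,\infty)$, $S$ has $r$-comparison relative to $w$ if whenever $x,y\in S$ satisfy $\widehat{x}+r\cdot\widehat{w}\leq\widehat{y}$, then $x\leq y$. $\mathrm{rc}(S,w)$ is the infimum of all $r\in(0,\infty)$ such that $S$ has $r$-comparison relative to $w$, and $\mathrm{rc}(S,w)=\infty$ if there is no such $r$. Convention: $\gamma\cdot\infty=\infty$ for $\gamma\in(0,\infty)$. (Under the hypotheses, $0<\rho(x,y)\leq1$.) *)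

(* Defs.v *)
From HB Require Import structures.
From mathcomp Require Import all_boot all_order all_algebra.
From mathcomp Require Import mathcomp_extra boolp classical_sets functions.
From mathcomp Require Import reals ereal topology normedtype sequences.

Set Implicit Arguments.
Unset Strict Implicit.
Unset Printing Implicit Defensive.

Import Order.TTheory GRing.Theory Num.Theory.

Local Open Scope classical_set_scope.
Local Open Scope ring_scope.

(* "Increasing" is read as "nondecreasing" throughout.  [supremums A s] says
   that [s] is the least upper bound of [A]. *)

Definition way_below d (P : porderType d) (x y : P) : Prop :=
  forall u : nat -> P, nondecreasing_seq u -> supremums (range u) y ->
    exists n, (x <= u n)%O.

(* MathComp's [nmodType] and [porderType] cannot be joined by HB into a new
   structure (their join is reserved for [Num.POrderedZmodule]), so the abelian
   monoid structure is given by a commutative monoid law on the ordered set. *)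
HB.mixin Record isCuSemigroup (d : Order.disp_t) S of Order.POrder d S := {
  cu0 : S ;
  cu_add : Monoid.com_law cu0 ;
  cu_ge0 : forall x : S, (cu0 <= x)%O ;
  cu_leD : forall x y z t : S, (x <= y)%O -> (z <= t)%O ->
    (cu_add x z <= cu_add y t)%O ;
  cu_O1 : forall u : nat -> S, nondecreasing_seq u ->
    exists s, supremums (range u) s ;
  cu_O2 : forall x : S, exists u : nat -> S,
    (forall n, way_below (u n) (u n.+1)) /\ supremums (range u) x ;
  cu_O3 : forall x' x y' y : S, way_below x' x -> way_below y' y ->
    way_below (cu_add x' y') (cu_add x y) ;
  cu_O4 : forall (u v : nat -> S) (s t : S),
    nondecreasing_seq u -> nondecreasing_seq v ->
    supremums (range u) s -> supremums (range v) t ->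
    supremums (range (fun n => cu_add (u n) (v n))) (cu_add s t)
}.

#[short(type="cuSemigroupType")]
HB.structure Definition CuSemigroup (d : Order.disp_t) :=
  { S of isCuSemigroup d S & Order.POrder d S }.

Section CuSemigroups.
Context (d : Order.disp_t) (S : cuSemigroupType d).

Definition cu_muln (n : nat) (x : S) : S := iter n (cu_add x) cu0.

(* The default value [cu0] is irrelevant: the sequence is nondecreasing, so
   its supremum exists by [cu_O1]. *)
Definition infty_mul (x : S) : S :=
  supremum cu0 (range (fun n => cu_muln n x)).

Definition Full : set S := [set x | forall z : S, (z <= infty_mul x)%O].

Context (R : realType).
Local Open Scope ereal_scope.

Record functional := Functional {
  functional_fun :> S -> \bar R ;
  functional_ge0 : forall x, 0 <= functional_fun x ;
  functional0 : functional_fun cu0 = 0 ;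
  functionalD : forall x y,
    functional_fun (cu_add x y) = functional_fun x + functional_fun y ;
  functional_le : forall x y, (x <= y)%O ->
    functional_fun x <= functional_fun y ;
  functional_sup : forall (u : nat -> S) (s : S), nondecreasing_seq u ->
    supremums (range u) s ->
    functional_fun s = ereal_sup (range (fun n => functional_fun (u n)))
}.

Definition functionals_at (z : S) : set functional :=
  [set lambda | lambda z = 1].

Definition rank (x : S) (lambda : functional) : \bar R := lambda x.

(* The infimum of the empty set is +oo, which covers the cases in which there
   is no suitable r; likewise for [radius_comparison]. *)
Definition rank_ratio (x y : S) : \bar R :=
  ereal_inf [set r%:E | r in [set r : R | (0 < r)%R /\
    forall lambda, rank x lambda <= r%:E * rank y lambda]].

Definition has_comparison (w : S) (r : R) : Prop :=
  forall x y : S,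
    (forall lambda, rank x lambda + r%:E * rank w lambda <= rank y lambda) ->
    (x <= y)%O.

Definition radius_comparison (w : S) : \bar R :=
  ereal_inf [set r%:E | r in [set r : R | (0 < r)%R /\ has_comparison w r]].

End CuSemigroups.

Arguments Full {d} S.
Arguments functionals_at {d S} R z.
Arguments rank_ratio {d S} R x y.
Arguments radius_comparison {d S} R w.

(* Main.v *)
Require Import Defs.
From mathcomp Require Import all_boot all_order all_algebra.
From mathcomp Require Import boolp classical_sets reals ereal.

Import Order.TTheory GRing.Theory Num.Theory.

(* If the rank of [v] is at most [r] times that of [w], then [s]-comparison
   relative to [v] gives [rs]-comparison relative to [w].  Taking infima over [r]
   and [s], [rc(S, w) <= rho(v, w) rc(S, v)] as soon as [rho(v, w)] is positive
   and finite (at [rho = 0] the product [0 * +oo = 0] would break this).  Both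
   inequalities are instances; positivity comes from a functional normalised at
   [y], which cannot vanish on the full element [x]. *)

Section CuSemigroupTheory.
Local Open Scope classical_set_scope.
Local Open Scope ereal_scope.
Context (d : Order.disp_t) (S : cuSemigroupType d) (R : realType).
Implicit Types (v w x y : S) (lambda : functional S R).

Lemma cu_muln_nondecreasing x (m n : nat) :
  (m <= n)%N -> (cu_muln m x <= cu_muln n x)%O.
Proof.
move=> /subnK <-; elim: (n - m)%N => [|k IHk] //; apply: (le_trans IHk).
rewrite addSn {2}/cu_muln iterS -[X in (X <= _)%O](Monoid.mul1m (@cu_add d S)).
by apply: cu_leD => //; exact: cu_ge0.
Qed.

(** Neither default [cu0] in [supremum] is reached: the range contains the zeroth multiple, and (O1)
    provides a supremum. *)
Lemma infty_mul_supremums x :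
  supremums (range (fun n => cu_muln n x)) (infty_mul x).
Proof.
have [s sP] := cu_O1 _ (cu_muln_nondecreasing x).
rewrite /infty_mul /supremum; case: ifPn => [/eqP U0|_].
  by have : set0 (cu_muln 0 x) by rewrite -U0; exists 0%N.
by case: xgetP => [? _ //|/(_ s)]; case.
Qed.

Lemma functional_muln0 lambda x n : lambda x = 0 -> lambda (cu_muln n x) = 0.
Proof.
move=> x0; elim: n => [|n IHn]; first exact: functional0.
by rewrite /cu_muln iterS functionalD x0 add0e.
Qed.

(** If [lambda] vanished at [x], it would vanish on all multiples of [x], hence on their supremum,
    which dominates [y]. *)
Lemma functional_Full_gt0 lambda x y : Full S x -> 0 < lambda y -> 0 < lambda x.
Proof.
move=> hx y0; rewrite lt_neqAle functional_ge0 andbT eq_sym.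
apply: contraTneq y0 => x0; rewrite -leNgt.
apply: (le_trans (functional_le lambda (hx y))).
rewrite (functional_sup _ (cu_muln_nondecreasing x) (infty_mul_supremums x)).
by apply: ge_ereal_sup => _ [n _ <-]; rewrite functional_muln0.
Qed.

Lemma has_comparison_scale v w (r s : R) : (0 <= s)%R ->
  (forall lambda, rank v lambda <= r%:E * rank w lambda) ->
  has_comparison v s -> has_comparison w (r * s)%R.
Proof.
move=> s0 vw cs a b ab; apply: cs => lambda; apply: le_trans (ab lambda).
rewrite leeD2l// mulrC EFinM -muleA.
by apply: lee_wpmul2l; rewrite ?lee_fin.
Qed.

Lemma radius_comparison_le v w (c : R) : (0 < c)%R -> rank_ratio R v w = c%:E ->
  radius_comparison R w <= c%:E * radius_comparison R v.
Proof.
(* Dividing by [c], then by [s], leaves each infimum alone on the right, where it suffices to bound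
   its members [s] and [r] separately. *)
move=> c0 cE; rewrite -lee_pdivrMl//.
apply: le_ereal_inf_tmp => _ [s [s0 cs] <-]; rewrite lee_pdivrMl//.
rewrite muleC -lee_pdivrMl// -cE.
apply: le_ereal_inf_tmp => _ [r [r0 vw] <-]; rewrite lee_pdivrMl//.
apply: ge_ereal_inf; exists (r * s)%:E; last by rewrite mulrC EFinM.
exists (r * s)%R => //; split; first exact: mulr_gt0.
exact: has_comparison_scale (ltW s0) vw cs.
Qed.

Lemma rank_ratio_ge lambda v w : lambda w <= 1 -> lambda v <= rank_ratio R v w.
Proof.
move=> w1; apply: le_ereal_inf_tmp => _ [r [r0 vw] <-].
apply: (le_trans (vw lambda)); rewrite -[leRHS]mule1.
by apply: lee_wpmul2l => //; rewrite lee_fin ltW.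
Qed.

Lemma rank_ratio_le1 v w : (v <= w)%O -> rank_ratio R v w <= 1.
Proof.
move=> vw; apply: ge_ereal_inf; exists 1%:E => //; exists 1%R => //.
by split=> // lambda; rewrite mul1e; exact: functional_le.
Qed.

End CuSemigroupTheory.

Theorem theorem5p3 (R : realType) (d : Order.disp_t) (S : cuSemigroupType d)
    (x y : S) (hx : Full S x) (hy : Full S y) (hxy : (x <= y)%O)
    (hF : (functionals_at R y !=set0)%classic) :
  ((1 / rank_ratio R x y * radius_comparison R y <= radius_comparison R x)%E)
  /\
  ((rank_ratio R y x < +oo)%E ->
   (1 / rank_ratio R x y * radius_comparison R y <= radius_comparison R x)%E /\
   (radius_comparison R x <= rank_ratio R y x * radius_comparison R y)%E).
Proof.
have [lambda y1] := hF.
have ly0 : (0 < lambda y)%E by rewrite y1.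
have rho_xy0 : (0 < rank_ratio R x y)%E.
  apply: lt_le_trans (functional_Full_gt0 _ _ _ _ _ _ hx ly0) _.
  by apply: rank_ratio_ge; rewrite y1.
have rho_yx0 : (0 < rank_ratio R y x)%E.
  (* Since [lambda x <= lambda y = 1], the value [lambda y] is a lower bound for [rho(y, x)]. *)
  apply: lt_le_trans ly0 _; apply: rank_ratio_ge.
  by rewrite -y1; exact: functional_le.
have le_xy : (1 / rank_ratio R x y * radius_comparison R y
              <= radius_comparison R x)%E.
  (* The bound by 1 serves to exclude [rho(x, y) = +oo], so that the ratio is a positive real [c]
     with a genuine inverse. *)
  have := rank_ratio_le1 _ _ R _ _ hxy.
  case E : (rank_ratio R x y) rho_xy0 => [c| |] //; rewrite lte_fin => c0 _.
  by rewrite mul1e inver gt_eqF// lee_pdivrMl//; exact: radius_comparison_le.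
split=> // rho_fin; split=> //.
case E : (rank_ratio R y x) rho_yx0 rho_fin => [c| |] //; rewrite lte_fin => c0 _.
exact: radius_comparison_le.
Qed.
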